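(* Let $0\le n\le N-1$ and let $\mathbf E^n,\mathbf H^n$ be the solution of the ADI-FDTD scheme with the discrete PEC boundary condition (both defined in the context). Then $$\|\mathbf E^{n+1}\|_E^2+\|\mathbf H^{n+1}\|_H^2+\frac{(\Delta t)^2}{4\mu\varepsilon}\Big(\|\delta_2^h\mathbf H^{n+1}\|_E^2+\|\delta_1^h\mathbf E^{n+1}\|_H^2\Big)=\|\mathbf E^{n}\|_E^2+\|\mathbf H^{n}\|_H^2+\frac{(\Delta t)^2}{4\mu\varepsilon}\Big(\|\delta_2^h\mathbf H^{n}\|_E^2+\|\delta_1^h\mathbf E^{n}\|_H^2\Big).$$
   Context: **Grid.** $\varepsilon,\mu>0$ are constants; $I,J,K\ge2$ and $N\ge1$ are integers; $\Delta x=1/I$, $\Delta y=1/J$, $\Delta z=1/K$, $T>0$, $\Delta t=T/N$; $\Delta v=\Delta x\Delta y\Delta z$; $\bar l:=l+\tfrac12$ for $l=i,j,k,n$. A grid function carries spatial indices $(\alpha,\beta,\gamma)$ (integers or half-integers), referring to the point $(\alpha\Delta x,\beta\Delta y,\gamma\Delta z)$ of the unit cube, and a time index $m$ for time $m\Delta t$. ''$F|_{\alpha,\beta,\gamma}$'' means that all terms of $F$ are evaluated at spatial index $(\alpha,\beta,\gamma)$. The components live on staggered grids: $E_x$ at $(\bar i,j,k)$, $E_y$ at $(i,\bar j,k)$, $E_z$ at $(i,j,\bar k)$ (E-points); $H_x$ at $(i,\bar j,\bar k)$, $H_y$ at $(\bar i,j,\bar k)$, $H_z$ at $(\bar i,\bar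 j,k)$ (H-points). Here an integer $x$-index runs over $0,\dots,I$ and a half-integer one over $\tfrac12,\dots,I-\tfrac12$, similarly for $y$ (with $J$) and $z$ (with $K$). **Difference operators.** $\delta_xU_{\alpha,\beta,\gamma}=(U_{\alpha+\frac12,\beta,\gamma}-U_{\alpha-\frac12,\beta,\gamma})/\Delta x$, and $\delta_y,\delta_z$ analogously. For vector grid functions $\delta_1^h\mathbf U=(\delta_yU_z,\delta_zU_x,\delta_xU_y)$, $\delta_2^h\mathbf U=(\delta_zU_y,\delta_xU_z,\delta_yU_x)$. Thus the components of $\delta_1^h\mathbf E$ live at H-points and those of $\delta_2^h\mathbf H$ at (interior) E-points. Wherever a difference entering $\delta_1^h\mathbf E$ is taken at an H-point on the boundary of the cube, it only involves values of $\mathbf E$ on that boundary face. **ADI-FDTD scheme.** Given $\mathbf E^n,\mathbf H^n$, the fields $\mathbf E^{\bar n},\mathbf H^{\bar n}$ and $\mathbf E^{n+1},\mathbf H^{n+1}$ satisfy: Stage 1: $\frac{E_x^{\bar n}-E_x^n}{\Delta t}=\frac1{2\varepsilon}(\delta_yH_z^{\bar n}-\delta_zH_y^n)|_{\bar i,j,k}$, $\frac{E_y^{\bar n}-E_y^n}{\Delta t}=\frac1{2\varepsilon}(\delta_zH_x^{\bar n}-\delta_xH_z^n)|_{i,\bar j,k}$, $\frac{E_z^{\bar n}-E_z^n}{\Delta t}=\frac1{2\varepsilon}(\delta_xH_y^{\bar n}-\delta_yH_x^n)|_{i,j,\bar k}$, $\frac{H_x^{\bar n}-H_x^n}{\Delta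 t}=\frac1{2\mu}(\delta_zE_y^{\bar n}-\delta_yE_z^n)|_{i,\bar j,\bar k}$, $\frac{H_y^{\bar n}-H_y^n}{\Delta t}=\frac1{2\mu}(\delta_xE_z^{\bar n}-\delta_zE_x^n)|_{\bar i,j,\bar k}$, $\frac{H_z^{\bar n}-H_z^n}{\Delta t}=\frac1{2\mu}(\delta_yE_x^{\bar n}-\delta_xE_y^n)|_{\bar i,\bar j,k}$. Stage 2: $\frac{E_x^{n+1}-E_x^{\bar n}}{\Delta t}=\frac1{2\varepsilon}(\delta_yH_z^{\bar n}-\delta_zH_y^{n+1})|_{\bar i,j,k}$, $\frac{E_y^{n+1}-E_y^{\bar n}}{\Delta t}=\frac1{2\varepsilon}(\delta_zH_x^{\bar n}-\delta_xH_z^{n+1})|_{i,\bar j,k}$, $\frac{E_z^{n+1}-E_z^{\bar n}}{\Delta t}=\frac1{2\varepsilon}(\delta_xH_y^{\bar n}-\delta_yH_x^{n+1})|_{i,j,\bar k}$, $\frac{H_x^{n+1}-H_x^{\bar n}}{\Delta t}=\frac1{2\mu}(\delta_zE_y^{\bar n}-\delta_yE_z^{n+1})|_{i,\bar j,\bar k}$, $\frac{H_y^{n+1}-H_y^{\bar n}}{\Delta t}=\frac1{2\mu}(\delta_xE_z^{\bar n}-\delta_zE_x^{n+1})|_{\bar i,j,\bar k}$, $\frac{H_z^{n+1}-H_z^{\bar n}}{\Delta t}=\frac1{2\mu}(\delta_yE_x^{\bar n}-\delta_xE_y^{n+1})|_{\bar i,\bar j,k}$. The $\mathbf E$-equations hold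 at the E-points not lying on a face where that component is tangential (i.e. its integer indices are strictly between the endpoints); the $\mathbf H$-equations hold at all H-points. *Discrete PEC boundary condition*, for all integer and half-integer time levels $m$: $E_x^m=0$ if its $y$-index is $0$ or $J$ or its $z$-index is $0$ or $K$; $E_y^m=0$ if its $x$-index is $0$ or $I$ or its $z$-index is $0$ or $K$; $E_z^m=0$ if its $x$-index is $0$ or $I$ or its $y$-index is $0$ or $J$. **Norms.** The weight $P(\cdot)$ equals $\varepsilon$ for grid functions obtained from the electric field ($\mathbf E$, $\delta_1^h\mathbf E$) and $\mu$ for those obtained from the magnetic field ($\mathbf H$, $\delta_2^h\mathbf H$). For $\mathbf U$ on E-points and $\mathbf V$ on H-points, $$\|\mathbf U\|_E^2=\Delta v\,P(\mathbf U)\Big[\sum_{i=0}^{I-1}\sum_{j=1}^{J-1}\sum_{k=1}^{K-1}U_x^2|_{\bar i,j,k}+\sum_{i=1}^{I-1}\sum_{j=0}^{J-1}\sum_{k=1}^{K-1}U_y^2|_{i,\bar j,k}+\sum_{i=1}^{I-1}\sum_{j=1}^{J-1}\sum_{k=0}^{K-1}U_z^2|_{i,j,\bar k}\Big],$$ $$\|\mathbf V\|_H^2=\Delta v\,P(\mathbf V)\Big[\sum_{i=0}^{I}\sum_{j=0}^{J-1}\sum_{k=0}^{K-1}V_x^2|_{i,\bar j,\bar k}+\sum_{i=0}^{I-1}\sum_{j=0}^{J}\sum_{k=0}^{K-1}V_y^2|_{\bar i,j,\bar k}+\sum_{i=0}^{I-1}\sum_{j=0}^{J-1}\sum_{k=0}^{K}V_z^2|_{\bar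 i,\bar j,k}\Big].$$ *)

(* Defs.v *)
From mathcomp Require Import all_boot all_order all_algebra.
From mathcomp Require Import reals.

Set Implicit Arguments.
Unset Strict Implicit.
Unset Printing Implicit Defensive.

Import Order.TTheory GRing.Theory Num.Theory.
Local Open Scope ring_scope.

(* A spatial index that is an integer or a half-integer is represented by its
   double: [a : int] stands for the index [a / 2].  Hence the integer [l] is
   [whole l], [l + 1/2] is [half l], and a shift by 1/2 is a shift by 1.
   Grid functions are total; their values outside their own staggered grid are
   unconstrained and are never read by the definitions below. *)
Definition whole (l : nat) : int := (2 * l)%N%:Z.
Definition half (l : nat) : int := (2 * l + 1)%N%:Z.

(* Time levels are doubled in the same way. *)
Definition lev (n : nat) : nat := n.*2.
Definition levh (n : nat) : nat := n.*2.+1.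

Section ADI_FDTD.
Variable R : realType.

Definition gridfun := int -> int -> int -> R.

Record vgridfun := VGridFun { xc : gridfun; yc : gridfun; zc : gridfun }.

Section Grid.
Variables I J K : nat.

Definition Dx : R := I%:R^-1.
Definition Dy : R := J%:R^-1.
Definition Dz : R := K%:R^-1.
Definition Dv : R := Dx * Dy * Dz.

Definition delta_x (U : gridfun) : gridfun :=
  fun a b c => (U (a + 1) b c - U (a - 1) b c) / Dx.
Definition delta_y (U : gridfun) : gridfun :=
  fun a b c => (U a (b + 1) c - U a (b - 1) c) / Dy.
Definition delta_z (U : gridfun) : gridfun :=
  fun a b c => (U a b (c + 1) - U a b (c - 1)) / Dz.

Definition delta1 (U : vgridfun) : vgridfun :=
  VGridFun (delta_y (zc U)) (delta_z (xc U)) (delta_x (yc U)).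
Definition delta2 (U : vgridfun) : vgridfun :=
  VGridFun (delta_z (yc U)) (delta_x (zc U)) (delta_y (xc U)).

(* Squared norms; the weight [P] (the permittivity or the permeability,
   according to the field the grid function is obtained from) is an argument. *)
Definition normE2 (P : R) (U : vgridfun) : R :=
  Dv * P *
  ( \sum_(0 <= i < I) \sum_(1 <= j < J) \sum_(1 <= k < K)
      xc U (half i) (whole j) (whole k) ^+ 2
  + \sum_(1 <= i < I) \sum_(0 <= j < J) \sum_(1 <= k < K)
      yc U (whole i) (half j) (whole k) ^+ 2
  + \sum_(1 <= i < I) \sum_(1 <= j < J) \sum_(0 <= k < K)
      zc U (whole i) (whole j) (half k) ^+ 2 ).

Definition normH2 (P : R) (V : vgridfun) : R :=
  Dv * P *
  ( \sum_(0 <= i < I.+1) \sum_(0 <= j < J) \sum_(0 <= k < K)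
      xc V (whole i) (half j) (half k) ^+ 2
  + \sum_(0 <= i < I) \sum_(0 <= j < J.+1) \sum_(0 <= k < K)
      yc V (half i) (whole j) (half k) ^+ 2
  + \sum_(0 <= i < I) \sum_(0 <= j < J) \sum_(0 <= k < K.+1)
      zc V (half i) (half j) (whole k) ^+ 2 ).

Definition PEC (E : vgridfun) : Prop :=
  [/\ forall i j k, (i < I)%N -> (j <= J)%N -> (k <= K)%N ->
        [\/ j = 0%N, j = J, k = 0%N | k = K] ->
        xc E (half i) (whole j) (whole k) = 0,
      forall i j k, (i <= I)%N -> (j < J)%N -> (k <= K)%N ->
        [\/ i = 0%N, i = I, k = 0%N | k = K] ->
        yc E (whole i) (half j) (whole k) = 0
    & forall i j k, (i <= I)%N -> (j <= J)%N -> (k < K)%N ->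
        [\/ i = 0%N, i = I, j = 0%N | j = J] ->
        zc E (whole i) (whole j) (half k) = 0 ].

(* [F] holds at the E-points that are not on a tangential face, for the
   respective component. *)
Definition at_xE (F : int -> int -> int -> Prop) : Prop :=
  forall i j k, (i < I)%N -> (0 < j < J)%N -> (0 < k < K)%N ->
    F (half i) (whole j) (whole k).
Definition at_yE (F : int -> int -> int -> Prop) : Prop :=
  forall i j k, (0 < i < I)%N -> (j < J)%N -> (0 < k < K)%N ->
    F (whole i) (half j) (whole k).
Definition at_zE (F : int -> int -> int -> Prop) : Prop :=
  forall i j k, (0 < i < I)%N -> (0 < j < J)%N -> (k < K)%N ->
    F (whole i) (whole j) (half k).

Definition at_xH (F : int -> int -> int -> Prop) : Prop :=
  forall i j k, (i <= I)%N -> (j < J)%N -> (k < K)%N ->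
    F (whole i) (half j) (half k).
Definition at_yH (F : int -> int -> int -> Prop) : Prop :=
  forall i j k, (i < I)%N -> (j <= J)%N -> (k < K)%N ->
    F (half i) (whole j) (half k).
Definition at_zH (F : int -> int -> int -> Prop) : Prop :=
  forall i j k, (i < I)%N -> (j < J)%N -> (k <= K)%N ->
    F (half i) (half j) (whole k).

Section Scheme.
Variables eps mu T : R.
Variable N : nat.

Definition Dt : R := T / N%:R.

(* [E], [H] are the fields at level n and [E'], [H'] those at level n + 1/2. *)
Record stage1 (E H E' H' : vgridfun) : Prop := Stage1 {
  stage1_Ex : at_xE (fun a b c => (xc E' a b c - xc E a b c) / Dt =
    (2 * eps)^-1 * (delta_y (zc H') a b c - delta_z (yc H) a b c));
  stage1_Ey : at_yE (fun a b c => (yc E' a b c - yc E a b c) / Dt =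
    (2 * eps)^-1 * (delta_z (xc H') a b c - delta_x (zc H) a b c));
  stage1_Ez : at_zE (fun a b c => (zc E' a b c - zc E a b c) / Dt =
    (2 * eps)^-1 * (delta_x (yc H') a b c - delta_y (xc H) a b c));
  stage1_Hx : at_xH (fun a b c => (xc H' a b c - xc H a b c) / Dt =
    (2 * mu)^-1 * (delta_z (yc E') a b c - delta_y (zc E) a b c));
  stage1_Hy : at_yH (fun a b c => (yc H' a b c - yc H a b c) / Dt =
    (2 * mu)^-1 * (delta_x (zc E') a b c - delta_z (xc E) a b c));
  stage1_Hz : at_zH (fun a b c => (zc H' a b c - zc H a b c) / Dt =
    (2 * mu)^-1 * (delta_y (xc E') a b c - delta_x (yc E) a b c)) }.

(* [E'], [H'] are the fields at level n + 1/2 and [E''], [H''] those at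
   level n + 1. *)
Record stage2 (E' H' E'' H'' : vgridfun) : Prop := Stage2 {
  stage2_Ex : at_xE (fun a b c => (xc E'' a b c - xc E' a b c) / Dt =
    (2 * eps)^-1 * (delta_y (zc H') a b c - delta_z (yc H'') a b c));
  stage2_Ey : at_yE (fun a b c => (yc E'' a b c - yc E' a b c) / Dt =
    (2 * eps)^-1 * (delta_z (xc H') a b c - delta_x (zc H'') a b c));
  stage2_Ez : at_zE (fun a b c => (zc E'' a b c - zc E' a b c) / Dt =
    (2 * eps)^-1 * (delta_x (yc H') a b c - delta_y (xc H'') a b c));
  stage2_Hx : at_xH (fun a b c => (xc H'' a b c - xc H' a b c) / Dt =
    (2 * mu)^-1 * (delta_z (yc E') a b c - delta_y (zc E'') a b c));
  stage2_Hy : at_yH (fun a b c => (yc H'' a b c - yc H' a b c) / Dt =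
    (2 * mu)^-1 * (delta_x (zc E') a b c - delta_z (xc E'') a b c));
  stage2_Hz : at_zH (fun a b c => (zc H'' a b c - zc H' a b c) / Dt =
    (2 * mu)^-1 * (delta_y (xc E') a b c - delta_x (yc E'') a b c)) }.

Record ADI_solution (E H : nat -> vgridfun) : Prop := ADISolution {
  ADI_stage1 : forall n, (n < N)%N ->
    stage1 (E (lev n)) (H (lev n)) (E (levh n)) (H (levh n));
  ADI_stage2 : forall n, (n < N)%N ->
    stage2 (E (levh n)) (H (levh n)) (E (lev n.+1)) (H (lev n.+1));
  ADI_PEC : forall m, (m <= lev N)%N -> PEC (E m) }.

End Scheme.
End Grid.
End ADI_FDTD.

(* Main.v *)
Require Import Defs.
From mathcomp Require Import all_boot all_order all_algebra.
From mathcomp Require Import reals.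
From mathcomp Require Import zify ring.
(* [half] has to denote the half-integer index, not the halving of [nat]. *)
Import Defs.

Set Implicit Arguments.
Unset Strict Implicit.
Unset Printing Implicit Defensive.

Import Order.TTheory GRing.Theory Num.Theory.
Local Open Scope ring_scope.

(** With [c = Dt / 2], moving the unknowns of each equation of the scheme to one
    side turns the two stages into
      [E' - c/eps delta1 H' = E - c/eps delta2 H],
      [H' - c/mu  delta2 E' = H - c/mu  delta1 E],
    and
      [E' + c/eps delta1 H' = E'' + c/eps delta2 H''],
      [H' + c/mu  delta2 E' = H'' + c/mu  delta1 E''].
    Take the squared norms of the two sides, weight them by [eps] and [mu], and
    add.  The cross terms are [<E', delta1 H'> + <delta2 E', H'>] in the
    half-level fields, and the same with [delta1] and [delta2] exchanged in the
    fields at integer levels.  Both vanish: summation by parts makes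
    [- delta2] adjoint to [delta1], and the PEC condition kills the boundary
    terms ([dotE_delta1], [dotE_delta2]).  What survives is an energy in which
    the sign of [c] has disappeared ([energy_axpy]).  Hence both the energy at
    level [n] and the one at level [n + 1] equal the energy of the half-level
    fields, where the roles of [delta1] and [delta2] are exchanged. *)

(** * Discrete summation by parts *)

Lemma wholeD1 l : whole l + 1 = half l.
Proof. by rewrite /whole /half PoszD. Qed.

Lemma halfB1 l : half l - 1 = whole l.
Proof. by rewrite -wholeD1 addrK. Qed.

Lemma halfD1 l : half l + 1 = whole l.+1.
Proof. by rewrite -[1]/(Posz 1) -PoszD; congr Posz; lia. Qed.

Lemma wholeSB1 l : whole l.+1 - 1 = half l.
Proof. by rewrite -halfD1 addrK. Qed.

Lemma sum_nat_trim (V : nmodType) (L : nat) (f : nat -> V) :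
    (0 < L)%N -> f 0%N = 0 -> f L = 0 ->
  \sum_(0 <= l < L.+1) f l = \sum_(1 <= l < L) f l.
Proof.
by move=> L_gt0 f0 fL; rewrite big_nat_recr //= fL addr0 big_ltn // f0 add0r.
Qed.

Lemma sum_by_parts (A : pzRingType) (M : nat) (f g : int -> A) :
    (0 < M)%N -> f (whole 0) = 0 -> f (whole M) = 0 ->
  \sum_(1 <= m < M) f (whole m) * (g (whole m + 1) - g (whole m - 1))
  = - \sum_(0 <= m < M) (f (half m + 1) - f (half m - 1)) * g (half m).
Proof.
case: M => // M _ f0 fM.
under eq_bigr do rewrite mulrBr wholeD1.
under [in RHS]eq_bigr do rewrite halfD1 halfB1 mulrBl.
rewrite !sumrB opprB; congr (_ - _).
  by rewrite [RHS]big_ltn // f0 mul0r add0r.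
rewrite big_add1 /= [RHS]big_nat_recr //= fM mul0r addr0.
by apply: eq_bigr => m _; rewrite wholeSB1.
Qed.

(** The grid of [g] and of the differences of [f] reaches up to the faces
    [l = 0] and [l = L] transverse to the direction of differencing; there [f]
    vanishes together with its differences, so the larger range costs nothing. *)
Lemma sum_by_parts_l (A : comPzRingType) (M L : nat) (d : A)
    (f g : int -> int -> A) :
    (0 < M)%N -> (0 < L)%N ->
    (forall m l, (m <= M)%N -> (l <= L)%N ->
       [\/ m = 0%N, m = M, l = 0%N | l = L] -> f (whole m) (whole l) = 0) ->
  \sum_(1 <= m < M) \sum_(1 <= l < L) f (whole m) (whole l)
     * ((g (whole m + 1) (whole l) - g (whole m - 1) (whole l)) * d)
  = - \sum_(0 <= m < M) \sum_(0 <= l < L.+1)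
     ((f (half m + 1) (whole l) - f (half m - 1) (whole l)) * d)
     * g (half m) (whole l).
Proof.
move=> M_gt0 L_gt0 f0.
have trim m : (m < M)%N ->
  \sum_(0 <= l < L.+1)
     ((f (half m + 1) (whole l) - f (half m - 1) (whole l)) * d)
     * g (half m) (whole l)
  = \sum_(1 <= l < L)
     ((f (half m + 1) (whole l) - f (half m - 1) (whole l)) * d)
     * g (half m) (whole l).
  move=> lt_mM; rewrite sum_nat_trim // halfD1 halfB1.
    by rewrite !f0 ?(ltnW lt_mM) ?subr0 ?mul0r //; apply: Or43.
  by rewrite !f0 ?(ltnW lt_mM) ?subr0 ?mul0r //; apply: Or44.
rewrite [in RHS]big_nat; under [in RHS]eq_bigr => m /andP[_ ltM] do rewrite trim //.
rewrite -big_nat exchange_big [in RHS]exchange_big /= -sumrN.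
rewrite big_nat [RHS]big_nat; apply: eq_bigr => l /andP[l_gt0 lt_lL].
have le_lL := ltnW lt_lL.
under eq_bigr do rewrite mulrA; rewrite -mulr_suml.
under [in RHS]eq_bigr do rewrite mulrAC.
rewrite -mulr_suml -mulNr; congr (_ * _).
apply: (@sum_by_parts _ _ (f ^~ (whole l)) (g ^~ (whole l))) => //=.
  by apply: f0 => //; apply: Or41.
by apply: f0 => //; apply: Or42.
Qed.

Lemma sum_by_parts_r (A : comPzRingType) (M L : nat) (d : A)
    (f g : int -> int -> A) :
    (0 < M)%N -> (0 < L)%N ->
    (forall l m, (l <= L)%N -> (m <= M)%N ->
       [\/ l = 0%N, l = L, m = 0%N | m = M] -> f (whole l) (whole m) = 0) ->
  \sum_(1 <= l < L) \sum_(1 <= m < M) f (whole l) (whole m)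
     * ((g (whole l) (whole m + 1) - g (whole l) (whole m - 1)) * d)
  = - \sum_(0 <= l < L.+1) \sum_(0 <= m < M)
     ((f (whole l) (half m + 1) - f (whole l) (half m - 1)) * d)
     * g (whole l) (half m).
Proof.
move=> M_gt0 L_gt0 f0; rewrite exchange_big [in RHS]exchange_big /=.
apply: (@sum_by_parts_l _ _ _ _ (fun a b => f b a) (fun a b => g b a)) => //.
by move=> m l leM leL bd; apply: f0 => //; case: bd => ->;
  [apply: Or43|apply: Or44|apply: Or41|apply: Or42].
Qed.

(** * Inner products on the staggered grids *)

Section InnerProducts.
Variable R : realType.
Implicit Types (F G : gridfun R) (E H U V : vgridfun R).

Definition dot (p q r : nat -> int) (s t u : seq nat) F G : R :=
  \sum_(i <- s) \sum_(j <- t) \sum_(k <- u)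
    F (p i) (q j) (r k) * G (p i) (q j) (r k).

Lemma dot_axpy p q r s t u F G (c : R) :
  dot p q r s t u (fun a b d => F a b d + c * G a b d)
                  (fun a b d => F a b d + c * G a b d)
  = dot p q r s t u F F + c * (dot p q r s t u F G *+ 2)
    + c ^+ 2 * dot p q r s t u G G.
Proof.
rewrite /dot -sumrMnl !mulr_sumr -!big_split; apply: eq_bigr => i _ /=.
rewrite -sumrMnl !mulr_sumr -!big_split; apply: eq_bigr => j _ /=.
rewrite -sumrMnl !mulr_sumr -!big_split; apply: eq_bigr => k _ /=.
by ring.
Qed.

Lemma eq_dot p q r s t u F G :
    (forall i j k, i \in s -> j \in t -> k \in u ->
       F (p i) (q j) (r k) = G (p i) (q j) (r k)) ->
  dot p q r s t u F F = dot p q r s t u G G.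
Proof.
move=> eqFG; apply: eq_big_seq => i si; apply: eq_big_seq => j tj.
by apply: eq_big_seq => k uk; rewrite eqFG.
Qed.

Definition axpy (c : R) U V : vgridfun R :=
  VGridFun (fun a b d => xc U a b d + c * xc V a b d)
           (fun a b d => yc U a b d + c * yc V a b d)
           (fun a b d => zc U a b d + c * zc V a b d).

Section Grid.
Variables I J K : nat.

Local Notation rg m n := (index_iota m n).

Definition dotE U V : R :=
  dot half whole whole (rg 0 I) (rg 1 J) (rg 1 K) (xc U) (xc V)
  + dot whole half whole (rg 1 I) (rg 0 J) (rg 1 K) (yc U) (yc V)
  + dot whole whole half (rg 1 I) (rg 1 J) (rg 0 K) (zc U) (zc V).

Definition dotH U V : R :=
  dot whole half half (rg 0 I.+1) (rg 0 J) (rg 0 K) (xc U) (xc V)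
  + dot half whole half (rg 0 I) (rg 0 J.+1) (rg 0 K) (yc U) (yc V)
  + dot half half whole (rg 0 I) (rg 0 J) (rg 0 K.+1) (zc U) (zc V).

Lemma normE2_dot P U : normE2 I J K P U = Dv R I J K * P * dotE U U.
Proof. by []. Qed.

Lemma normH2_dot P U : normH2 I J K P U = Dv R I J K * P * dotH U U.
Proof. by []. Qed.

Lemma dotE_axpy c U V :
  dotE (axpy c U V) (axpy c U V)
  = dotE U U + c * (dotE U V *+ 2) + c ^+ 2 * dotE V V.
Proof. by rewrite /dotE !dot_axpy; ring. Qed.

Lemma dotH_axpy c U V :
  dotH (axpy c U V) (axpy c U V)
  = dotH U U + c * (dotH U V *+ 2) + c ^+ 2 * dotH V V.
Proof. by rewrite /dotH !dot_axpy; ring. Qed.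

Lemma dotH_sym U V : dotH U V = dotH V U.
Proof.
by congr (_ + _ + _); apply: eq_bigr => i _; apply: eq_bigr => j _;
  apply: eq_bigr => k _; rewrite mulrC.
Qed.

Definition eqE U V : Prop :=
  [/\ at_xE I J K (fun a b c => xc U a b c = xc V a b c),
      at_yE I J K (fun a b c => yc U a b c = yc V a b c)
    & at_zE I J K (fun a b c => zc U a b c = zc V a b c)].

Definition eqH U V : Prop :=
  [/\ at_xH I J K (fun a b c => xc U a b c = xc V a b c),
      at_yH I J K (fun a b c => yc U a b c = yc V a b c)
    & at_zH I J K (fun a b c => zc U a b c = zc V a b c)].

Lemma eqE_dot U V : eqE U V -> dotE U U = dotE V V.
Proof.
case=> eqx eqy eqz; congr (_ + _ + _); apply: eq_dot => i j k;
  rewrite !mem_index_iota => ? ? ?; [exact: eqx|exact: eqy|exact: eqz].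
Qed.

Lemma eqH_dot U V : eqH U V -> dotH U U = dotH V V.
Proof.
case=> eqx eqy eqz; congr (_ + _ + _); apply: eq_dot => i j k;
  rewrite !mem_index_iota !ltnS => ? ? ?; [exact: eqx|exact: eqy|exact: eqz].
Qed.

(** * Adjointness of the two halves of the discrete curl *)

Section Adjoint.
Hypotheses (I_gt0 : (0 < I)%N) (J_gt0 : (0 < J)%N) (K_gt0 : (0 < K)%N).

Lemma dot_Ex_delta U G : PEC I J K U ->
  dot half whole whole (rg 0 I) (rg 1 J) (rg 1 K) (xc U) (delta_y J G)
    = - dot half half whole (rg 0 I) (rg 0 J) (rg 0 K.+1) (delta_y J (xc U)) G
  /\ dot half whole whole (rg 0 I) (rg 1 J) (rg 1 K) (xc U) (delta_z K G)
    = - dot half whole half (rg 0 I) (rg 0 J.+1) (rg 0 K) (delta_z K (xc U)) G.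
Proof.
case=> U0 _ _; split; rewrite /dot -sumrN big_nat [RHS]big_nat;
  apply: eq_bigr => i /andP[_ ltI].
- apply: (sum_by_parts_l (f := xc U (half i)) _ (G (half i))) => // j k.
  exact: U0.
- apply: (sum_by_parts_r (f := xc U (half i)) _ (G (half i))) => // j k.
  exact: U0.
Qed.

Lemma dot_Ey_delta U G : PEC I J K U ->
  dot whole half whole (rg 1 I) (rg 0 J) (rg 1 K) (yc U) (delta_x I G)
    = - dot half half whole (rg 0 I) (rg 0 J) (rg 0 K.+1) (delta_x I (yc U)) G
  /\ dot whole half whole (rg 1 I) (rg 0 J) (rg 1 K) (yc U) (delta_z K G)
    = - dot whole half half (rg 0 I.+1) (rg 0 J) (rg 0 K) (delta_z K (yc U)) G.
Proof.
case=> _ U0 _; split; rewrite /dot exchange_big [in RHS]exchange_big /= -sumrN;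
  rewrite big_nat [RHS]big_nat; apply: eq_bigr => j /andP[_ ltJ].
- apply: (sum_by_parts_l (f := fun a => yc U a (half j))
                         _ (fun a => G a (half j))) => // i k leI leK.
  exact: U0.
- apply: (sum_by_parts_r (f := fun a => yc U a (half j))
                         _ (fun a => G a (half j))) => // i k leI leK.
  exact: U0.
Qed.

Lemma dot_Ez_delta U G : PEC I J K U ->
  dot whole whole half (rg 1 I) (rg 1 J) (rg 0 K) (zc U) (delta_x I G)
    = - dot half whole half (rg 0 I) (rg 0 J.+1) (rg 0 K) (delta_x I (zc U)) G
  /\ dot whole whole half (rg 1 I) (rg 1 J) (rg 0 K) (zc U) (delta_y J G)
    = - dot whole half half (rg 0 I.+1) (rg 0 J) (rg 0 K) (delta_y J (zc U)) G.
Proof.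
have k_outer p q r s t u (A B : gridfun R) : dot p q r s t u A B =
    \sum_(k <- u) \sum_(i <- s) \sum_(j <- t)
      A (p i) (q j) (r k) * B (p i) (q j) (r k).
  rewrite [RHS]exchange_big; apply: eq_bigr => i _ /=.
  by rewrite exchange_big.
case=> _ _ U0; split; rewrite !k_outer -sumrN big_nat [RHS]big_nat;
  apply: eq_bigr => k /andP[_ ltK].
- apply: (sum_by_parts_l (f := fun a b => zc U a b (half k))
                         _ (fun a b => G a b (half k))) => // i j leI leJ.
  exact: U0.
- apply: (sum_by_parts_r (f := fun a b => zc U a b (half k))
                         _ (fun a b => G a b (half k))) => // i j leI leJ.
  exact: U0.
Qed.

(** The discrete counterpart of the self-adjointness of the curl on fields with
    vanishing tangential trace, split over the two halves of the curl. *)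
Lemma dotE_delta1 U V : PEC I J K U ->
  dotE U (delta1 I J K V) = - dotH (delta2 I J K U) V.
Proof.
move=> U0; rewrite /dotE /dotH /=.
rewrite (dot_Ex_delta _ U0).1 (dot_Ey_delta _ U0).2 (dot_Ez_delta _ U0).1.
by ring.
Qed.

Lemma dotE_delta2 U V : PEC I J K U ->
  dotE U (delta2 I J K V) = - dotH (delta1 I J K U) V.
Proof.
move=> U0; rewrite /dotE /dotH /=.
rewrite (dot_Ex_delta _ U0).2 (dot_Ey_delta _ U0).1 (dot_Ez_delta _ U0).2.
by ring.
Qed.

End Adjoint.

(** * Energy balance *)

Definition energy (eps mu c : R) E H U V : R :=
  eps * dotE E E + mu * dotH H H
  + c ^+ 2 * (eps^-1 * dotE U U + mu^-1 * dotH V V).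

(** The factors [c / eps] and [c / mu] give the two cross terms the same
    coefficient [2 * c], so adjointness cancels them.  In the use, [U] is one of
    the two halves of the curl of [H], and [V] the other half applied to [E]. *)
Lemma energy_axpy (eps mu c : R) E H U V :
    eps != 0 -> mu != 0 -> dotE E U = - dotH V H ->
  eps * dotE (axpy (c / eps) E U) (axpy (c / eps) E U)
  + mu * dotH (axpy (c / mu) H V) (axpy (c / mu) H V) = energy eps mu c E H U V.
Proof.
move=> eps0 mu0 adj; rewrite dotE_axpy dotH_axpy adj (dotH_sym V) /energy.
by field; rewrite eps0 mu0.
Qed.

Lemma energyN (eps mu c : R) E H U V :
  energy eps mu (- c) E H U V = energy eps mu c E H U V.
Proof. by rewrite /energy sqrrN. Qed.

Lemma energy_eq (eps mu c : R) E H U V E' H' U' V' :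
    eps != 0 -> mu != 0 ->
    dotE E U = - dotH V H -> dotE E' U' = - dotH V' H' ->
    eqE (axpy (c / eps) E U) (axpy (c / eps) E' U') ->
    eqH (axpy (c / mu) H V) (axpy (c / mu) H' V') ->
  energy eps mu c E H U V = energy eps mu c E' H' U' V'.
Proof.
move=> eps0 mu0 adj adj' eqEE eqHH.
by rewrite -!energy_axpy // (eqE_dot eqEE) (eqH_dot eqHH).
Qed.

Section Stages.
Variables (eps mu T : R) (N : nat).
Hypotheses (eps0 : eps != 0) (mu0 : mu != 0) (Dt0 : Dt T N != 0).
Hypotheses (I_gt0 : (0 < I)%N) (J_gt0 : (0 < J)%N) (K_gt0 : (0 < K)%N).

Local Notation c := (Dt T N / 2).

Let explicit_step (m x x' g g' : R) : m != 0 ->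
  (x' - x) / Dt T N = (2 * m)^-1 * (g' - g) ->
  x' - x = c / m * (g' - g).
Proof.
move=> m0 /(congr1 ( *%R^~ (Dt T N))); rewrite divfK // => ->.
by field.
Qed.

Let backward (m x x' g g' : R) : m != 0 ->
  (x' - x) / Dt T N = (2 * m)^-1 * (g' - g) ->
  x' + - c / m * g' = x + - c / m * g.
Proof.
move=> m0 /explicit_step-/(_ m0) e.
have -> : x' = x + c / m * (g' - g) by rewrite -e addrC subrK.
by ring.
Qed.

Let forward (m x x' g g' : R) : m != 0 ->
  (x' - x) / Dt T N = (2 * m)^-1 * (g - g') ->
  x' + c / m * g' = x + c / m * g.
Proof.
move=> m0 /explicit_step-/(_ m0) e.
have -> : x' = x + c / m * (g - g') by rewrite -e addrC subrK.
by ring.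
Qed.

Lemma stage1_energy E H E' H' :
    PEC I J K E -> PEC I J K E' -> stage1 I J K eps mu T N E H E' H' ->
  energy eps mu c E' H' (delta1 I J K H') (delta2 I J K E')
  = energy eps mu c E H (delta2 I J K H) (delta1 I J K E).
Proof.
move=> PE PE' [Ex Ey Ez Hx Hy Hz].
(* In this stage the known and unknown fields match with the step [- c]. *)
rewrite -[LHS]energyN -[RHS]energyN.
apply: energy_eq => //; try exact: dotE_delta1; try exact: dotE_delta2.
  split=> i j k ? ? ?; apply: backward => //;
    [exact: Ex|exact: Ey|exact: Ez].
split=> i j k ? ? ?; apply: backward => //;
  [exact: Hx|exact: Hy|exact: Hz].
Qed.

Lemma stage2_energy E' H' E'' H'' :
    PEC I J K E' -> PEC I J K E'' -> stage2 I J K eps mu T N E' H' E'' H'' ->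
  energy eps mu c E'' H'' (delta2 I J K H'') (delta1 I J K E'')
  = energy eps mu c E' H' (delta1 I J K H') (delta2 I J K E').
Proof.
move=> PE' PE'' [Ex Ey Ez Hx Hy Hz].
apply: energy_eq => //; try exact: dotE_delta1; try exact: dotE_delta2.
  split=> i j k ? ? ?; apply: forward => //;
    [exact: Ex|exact: Ey|exact: Ez].
split=> i j k ? ? ?; apply: forward => //;
  [exact: Hx|exact: Hy|exact: Hz].
Qed.

Lemma norms_energy E H :
  normE2 I J K eps E + normH2 I J K mu H
  + Dt T N ^+ 2 / (4 * mu * eps)
    * (normE2 I J K mu (delta2 I J K H) + normH2 I J K eps (delta1 I J K E))
  = Dv R I J K * energy eps mu c E H (delta2 I J K H) (delta1 I J K E).
Proof.
rewrite !normE2_dot !normH2_dot /energy.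
by field; rewrite eps0 mu0.
Qed.

End Stages.
End Grid.
End InnerProducts.

Theorem theorem3p4 (R : realType) (eps mu T : R) (I J K N : nat)
    (eps_gt0 : 0 < eps) (mu_gt0 : 0 < mu) (T_gt0 : 0 < T)
    (I_ge2 : (2 <= I)%N) (J_ge2 : (2 <= J)%N) (K_ge2 : (2 <= K)%N)
    (N_ge1 : (1 <= N)%N)
    (E H : nat -> vgridfun R) (EH_sol : ADI_solution I J K eps mu T N E H)
    (n : nat) (n_le : (n <= N - 1)%N) :
  normE2 I J K eps (E (lev n.+1)) + normH2 I J K mu (H (lev n.+1))
  + Dt T N ^+ 2 / (4 * mu * eps)
    * (normE2 I J K mu (delta2 I J K (H (lev n.+1)))
       + normH2 I J K eps (delta1 I J K (E (lev n.+1))))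
  = normE2 I J K eps (E (lev n)) + normH2 I J K mu (H (lev n))
  + Dt T N ^+ 2 / (4 * mu * eps)
    * (normE2 I J K mu (delta2 I J K (H (lev n)))
       + normH2 I J K eps (delta1 I J K (E (lev n)))).
Proof.
have [eps0 mu0] := (lt0r_neq0 eps_gt0, lt0r_neq0 mu_gt0).
have Dt0 : Dt T N != 0.
  by rewrite mulf_neq0 ?invr_eq0 ?(lt0r_neq0 T_gt0) // pnatr_eq0 -lt0n.
have [I_gt0 J_gt0 K_gt0] := And3 (ltnW I_ge2) (ltnW J_ge2) (ltnW K_ge2).
have lt_nN : (n < N)%N by lia.
case: EH_sol => /(_ n lt_nN) st1 /(_ n lt_nN) st2 pec.
have [P P' P''] : [/\ PEC I J K (E (lev n)), PEC I J K (E (levh n))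
                    & PEC I J K (E (lev n.+1))].
  by split; apply: pec; rewrite /lev /levh; lia.
rewrite !norms_energy //; congr (_ * _).
by rewrite (stage2_energy _ _ _ _ _ _ P' P'' st2) // (stage1_energy _ _ _ _ _ _ P P' st1).
Qed.
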